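(* It holds that $$\overline{\mathcal R(\mathcal T_K^* )}=\mathcal R(\mathcal T_K^* )=\mathcal R(\mathcal T_K^*\mathcal T_K).$$ That is, identification and strong identification of $\theta(h^\star)$ are equivalent.
   Context: $A$ is uniform on $[K]=\{1,\dots,K\}$ and $(A,S,Y)$ is a historical observation; $S^{\mathrm{new}}$ is the short-term outcome vector under a novel treatment, taking values in the same space as $S$. $L_2(S)$ is the Hilbert space of functions $h$ with $\|h\|^2=E[h(S)^2]<\infty$. $\mathcal H\subseteq L_2(S)$ is a closed linear subspace. $\mathcal Q$ is the space of functions $[K]\to\mathbb R$ with inner product $\langle f_1,f_2\rangle=\frac1K\sum_{a=1}^Kf_1(a)f_2(a)$. $\mathcal T_K:\mathcal H\to\mathcal Q$ is $(\mathcal T_Kh)(a)=E[h(S)\mid A=a]$, and $\mathcal T_K^*:\mathcal Q\to\mathcal H$ is its adjoint. $\mathcal R(\cdot)$ denotes range and the overline denotes closure. $h^\star\in\mathcal H$ is a function with $E[h^\star(S)\mid A=a]=E[Y\mid A=a]$ for all $a\in[K]$. For $h\in\mathcal H$, $\theta(h)=E[h(S^{\mathrm{new}})]$. Let $\rho_K=p_{S^{\mathrm{new}}}/p_S$ be the density ratio (assumed in $L_2(S)$), and let $\alpha_K=\Pi(\rho_K\mid\mathcal H)$ be its $L_2$ projection on $\mathcal H$, so that $\theta(h)=E[\alpha_K(S)h(S)]$ for all $h\in\mathcal H$. Identification: $\theta(h^\star)$ is identified if $\theta(h)=\theta(h^\star)$ for every $h\in\mathcal H$ with $(\mathcal T_Kh)(a)=E[Y\mid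 A=a]$ for all $a\in[K]$; equivalently $\alpha_K\in\mathcal N(\mathcal T_K)^\perp=\overline{\mathcal R(\mathcal T_K^* )}$, with $\mathcal N$ the null space. Strong identification: $\theta(h^\star)$ is strongly identified if $\alpha_K\in\mathcal R(\mathcal T_K^*\mathcal T_K)$, i.e. there is $\xi\in\mathcal H$ with $\mathcal T_K^*\mathcal T_K\xi=\alpha_K$. *)

(* Defs.v *)
From HB Require Import structures.
From mathcomp Require Import all_boot all_order all_algebra.
From mathcomp Require Import all_classical all_reals all_analysis measurable_realfun.
Import Order.TTheory GRing.Theory Num.Theory.
Import numFieldNormedType.Exports.

Set Implicit Arguments.
Unset Strict Implicit.
Unset Printing Implicit Defensive.

Local Open Scope classical_set_scope.
Local Open Scope ring_scope.

(* MathComp-Analysis provides the vector space [LfunType] of p-integrable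
   functions and a bare quotient type [LspaceType] without algebraic or
   topological structure.  [L2 mu] below is the quotient of the former (p = 2)
   by the functions vanishing almost everywhere, with its normed-module
   structure, so that [closure] and [closed] refer to the L2-norm topology. *)

Section L2_space.
Context d (T : measurableType d) (R : realType).
Variable mu : {measure set T -> \bar R}.

Local Notation LF := (LfunType mu (lee1n 2 : (1 <= 2%:R%:E :> \bar R)%E)).

Definition ae_null : {pred LF} := fun f => `[< (f : T -> R) = cst 0 %[ae mu] >].

Lemma ae_nullP (f : LF) :
  reflect ((f : T -> R) = cst 0 %[ae mu]) (f \in ae_null).
Proof. exact: asboolP. Qed.

Lemma ae_null_zmod_closed : zmod_closed ae_null.
Proof.
split; first by apply/ae_nullP; apply: aeW.
move=> f g /ae_nullP f0 /ae_nullP g0; apply/ae_nullP.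
apply: filterS2 f0 g0 => x /(_ I) /= fx /(_ I) /= gx _.
by rewrite -[LHS]/(f x - g x) fx gx subr0.
Qed.

HB.instance Definition _ := GRing.isZmodClosed.Build LF ae_null
  ae_null_zmod_closed.

Definition L2 : Type := Quotient.quot (ae_null : zmodClosed LF).
HB.instance Definition _ := GRing.Zmodule.on L2.
HB.instance Definition _ := EqQuotient.on L2.

Definition L2_fun (f : L2) : T -> R := repr f.

Definition to_L2 (f : LF) : L2 := \pi_L2%qT f.

Lemma to_L2K (f : L2) : to_L2 (repr f) = f.
Proof. exact: reprK. Qed.

Lemma to_L2P (f g : LF) :
  to_L2 f = to_L2 g <-> (f : T -> R) = g %[ae mu].
Proof.
have E : (f - g \in ae_null) = (to_L2 f == to_L2 g).
  exact: Quotient.idealrBE.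
split.
  move=> /eqP; rewrite -E => /ae_nullP.
  by apply: filterS => x /(_ I) /eqP; rewrite -[(f - g) x]/(f x - g x) subr_eq0 => /eqP.
move=> fg; apply/eqP; rewrite -E; apply/ae_nullP.
by apply: filterS fg => x /(_ I) fgx _; rewrite -[LHS]/(f x - g x) fgx subrr.
Qed.

Lemma L2_fun_to_L2 (f : LF) : L2_fun (to_L2 f) = f %[ae mu].
Proof. by apply/to_L2P; rewrite to_L2K. Qed.

Lemma to_L2D (f g : LF) : to_L2 (f + g) = to_L2 f + to_L2 g.
Proof. exact: Quotient.pi_add. Qed.

Lemma to_L2_ae0 (f : LF) : to_L2 f = 0 <-> (f : T -> R) = cst 0 %[ae mu].
Proof.
have -> : (0 : L2) = to_L2 0 by rewrite /to_L2 !piE.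
exact: to_L2P.
Qed.

Definition L2_scale (a : R) (f : L2) : L2 := to_L2 (a *: repr f).

Lemma L2_scale_to_L2 a (f : LF) : L2_scale a (to_L2 f) = to_L2 (a *: f).
Proof.
apply/to_L2P; apply: filterS (L2_fun_to_L2 f) => x /(_ I) /= fx _.
by congr (a * _).
Qed.

Lemma L2_scaleA a b f : L2_scale a (L2_scale b f) = L2_scale (a * b) f.
Proof. by rewrite -(to_L2K f) !L2_scale_to_L2 scalerA. Qed.

Lemma L2_scale1 : left_id 1 L2_scale.
Proof. by move=> f; rewrite -(to_L2K f) L2_scale_to_L2 scale1r. Qed.

Lemma L2_scaleDr : right_distributive L2_scale +%R.
Proof.
move=> a f g; rewrite -(to_L2K f) -(to_L2K g) -to_L2D !L2_scale_to_L2.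
by rewrite scalerDr to_L2D.
Qed.

Lemma L2_scaleDl f : {morph L2_scale^~ f : a b / a + b}.
Proof. by move=> a b; rewrite -(to_L2K f) !L2_scale_to_L2 scalerDl to_L2D. Qed.

HB.instance Definition _ := GRing.Zmodule_isLmodule.Build R L2
  L2_scaleA L2_scale1 L2_scaleDr L2_scaleDl.

Lemma to_L2Z a (f : LF) : to_L2 (a *: f) = a *: to_L2 f.
Proof. by rewrite -L2_scale_to_L2. Qed.

Definition L2_norm (f : L2) : R := fine ('N[mu]_2%:E[EFin \o L2_fun f])%E.

Lemma ae_eq_Lnorm2 (f g : LF) : (f : T -> R) = g %[ae mu] ->
  ('N[mu]_2%:E[EFin \o f])%E = ('N[mu]_2%:E[EFin \o g])%E.
Proof.
move=> fg; rewrite unlock; congr poweR.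
have mp (h : LF) : measurable_fun [set: T]
    (EFin \o (fun x => `|h x| `^ 2)).
  apply/measurable_EFinP => /=.
  apply/(@measurableT_comp _ _ _ _ _ _ (fun x : R => x `^ 2)%R) => //.
  exact/measurableT_comp.
apply: ae_eq_integral => //; [exact: mp|exact: mp|].
by apply: filterS fg => x /(_ I) /= ->.
Qed.

Lemma L2_norm_to_L2 (f : LF) :
  L2_norm (to_L2 f) = fine ('N[mu]_2%:E[EFin \o f])%E.
Proof. by congr fine; apply: ae_eq_Lnorm2; exact: L2_fun_to_L2. Qed.

Lemma L2_ler_normD f g : L2_norm (f + g) <= L2_norm f + L2_norm g.
Proof.
rewrite -(to_L2K f) -(to_L2K g) -to_L2D !L2_norm_to_L2.
exact: ler_LnormD.
Qed.

Lemma L2_normrZ (a : R) f : L2_norm (a *: f) = `|a| * L2_norm f.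
Proof.
rewrite -(to_L2K f) -to_L2Z !L2_norm_to_L2.
apply/EFin_inj; rewrite EFinM !finite_norm_fine.
exact: LnormZ.
Qed.

Lemma L2_normr0_eq0 f : L2_norm f = 0 -> f = 0.
Proof.
rewrite -{2}(to_L2K f) => f0; apply/to_L2_ae0.
exact: fine_Lnormr_eq0 f0.
Qed.

HB.instance Definition _ := Lmodule_isNormed.Build R L2
  L2_ler_normD L2_normrZ L2_normr0_eq0.

Definition L2_dot (f g : L2) : R := \int[mu]_x (L2_fun f x * L2_fun g x).

End L2_space.

Coercion L2_fun : L2 >-> Funclass.

Section Hilbert_notions.
Context d (T : measurableType d) (R : realType).
Variable mu : {measure set T -> \bar R}.
Implicit Type H : set (L2 mu).

Definition closed_subspace H :=
  [/\ H 0, (forall (a : R) f g, H f -> H g -> H (a *: f + g)) & closed H].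

Definition is_projection H (f g : L2 mu) :=
  H g /\ forall h, H h -> L2_dot (f - g) h = 0.

Definition Q_dot K (f g : 'I_K -> R) : R :=
  K%:R^-1 * \sum_(a < K) f a * g a.

(* [U] is only applied to elements of [H]: it stands for an operator with
   domain [H], and [Uadj] for its adjoint with codomain [H]. *)
Definition is_adjoint H K (U : L2 mu -> 'I_K -> R)
    (Uadj : ('I_K -> R) -> L2 mu) :=
  (forall q, H (Uadj q)) /\
  (forall h q, H h -> Q_dot (U h) q = L2_dot h (Uadj q)).

Definition is_density (nu m : {measure set T -> \bar R}) (p : T -> R) :=
  [/\ measurable_fun setT p, (forall x, 0 <= p x) &
      forall B, measurable B -> m B = (\int[nu]_(x in B) (p x)%:E)%E].

End Hilbert_notions.

Section model.
Context d (Omega : measurableType d) (R : realType) (P : probability Omega R).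
Variables (K : nat) (A : Omega -> 'I_K).

(* The treatment set {1, ..., K} is indexed by ['I_K] = {0, ..., K - 1}. *)
Definition uniform_treatment :=
  forall a, measurable (A @^-1` [set a]) /\
            P (A @^-1` [set a]) = (K%:R^-1)%:E.

Definition cond_mean (X : Omega -> R) (a : 'I_K) : R :=
  (\int[P]_(w in A @^-1` [set a]) X w) / fine (P (A @^-1` [set a])).

Context d' (T : measurableType d') (S : {RV P >-> T}).

Definition cond_op (h : L2 (distribution P S)) : 'I_K -> R :=
  cond_mean (h \o S).

Context d'' (Omega' : measurableType d'') (P' : probability Omega' R).
Variable Snew : {RV P' >-> T}.

Definition theta (h : L2 (distribution P S)) : R :=
  fine ('E_P'[h \o Snew])%E.

Variables (Y : Omega -> R) (H : set (L2 (distribution P S))).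

Definition identified (hstar : L2 (distribution P S)) :=
  forall h, H h -> (forall a, cond_op h a = cond_mean Y a) ->
    theta h = theta hstar.

End model.

Arguments cond_op {d Omega R} P {K} A {d' T} S h a.
Arguments identified {d Omega R} P {K} A {d' T} S {d'' Omega' P'} Snew Y H hstar.

Definition strongly_identified d (T : measurableType d) (R : realType)
    (mu : {measure set T -> \bar R}) K (H : set (L2 mu))
    (U : L2 mu -> 'I_K -> R) (Uadj : ('I_K -> R) -> L2 mu) (alpha : L2 mu) :=
  exists2 xi, H xi & Uadj (U xi) = alpha.

(* Main.v *)
Require Import Defs.
From mathcomp Require Import all_boot all_order all_algebra.
From mathcomp Require Import all_classical all_reals all_analysis measurable_realfun.
Import Order.TTheory GRing.Theory Num.Theory.
Import numFieldNormedType.Exports.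

(** Write U for the conditional-mean operator, V for its adjoint, N(U) for the
null space of U in [H] and R for ranges.  Both claims come from the cycle

  R(V U) <= R(V) <= closure R(V) <= H /\ N(U)^perp <= R(V U),

in which all the inclusions are therefore equalities.  The first two are
trivial; the third holds because [H] is closed and orthogonality to a fixed
vector passes to limits by Cauchy-Schwarz ([closure_orthogonal]).  The last one,
[normal_range], is where finiteness of the treatment set enters: in the finite
dimensional space Q the self-adjoint operator U V has the same kernel as its
square, and this kernel is N(V), the annihilator of R(U); hence every U f is
of the form U V U V q ([op_range_adjoint_sqr]).  Then f - V U (V q) lies in
N(U), and it is also orthogonal to N(U) when f is, so it vanishes.  Closedness
of R(V) is thus a consequence of the cycle.

For the equivalence of the two notions of identification, [theta h] is the
inner product of [h] with the density ratio ([thetaE]), hence with [alpha] for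
[h] in [H].  Two solutions of the moment equation differ by an element of
N(U), and adding any element of N(U) to [hstar] gives a solution, so that
identification says exactly that [alpha] is orthogonal to N(U).  Since [alpha]
is in [H], the cycle turns this into membership in R(V U).

The density ratio formula requires changing variables along densities with
respect to a measure [nu] that need not be sigma-finite, where the
Radon-Nikodym theorem does not apply; [integral_density] does it directly, by
approximation with simple functions. *)

Local Open Scope classical_set_scope.
Local Open Scope ring_scope.

(** * The inner product of L2 *)

Section L2_inner_product.
Context {d} {T : measurableType d} {R : realType}.
Context {mu : {measure set T -> \bar R}}.
Implicit Types f g h : L2 mu.

Lemma measurable_L2_fun f : measurable_fun [set: T] (f : T -> R).
Proof. exact: measurable_funP (repr f). Qed.

Lemma L2_fun_Lfun2 f : (f : T -> R) \in Lfun mu 2%:E.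
Proof. exact: LfunP. Qed.

(** Elements of L2 are classes and [L2_fun] picks representatives, so the
pointwise formula survives only almost everywhere. *)
Lemma L2_funP (a : R) f g :
  (a *: f + g : L2 mu) = (fun x => a * f x + g x) %[ae mu].
Proof.
have := L2_fun_to_L2 (a *: repr f + repr g).
by rewrite to_L2D to_L2Z !to_L2K.
Qed.

Lemma integrable_L2_mul f g :
  mu.-integrable [set: T] (EFin \o (fun x => f x * g x)).
Proof.
apply/Lfun1_integrable; apply: Lfun2_mul_Lfun1; exact: L2_fun_Lfun2.
Qed.

Lemma L2_dotC f g : L2_dot f g = L2_dot g f.
Proof. by apply: eq_Rintegral => x _; rewrite mulrC. Qed.

Lemma L2_dotPl (a : R) f g h :
  L2_dot (a *: f + g) h = a * L2_dot f h + L2_dot g h.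
Proof.
have mfg (u v : L2 mu) : measurable_fun [set: T] (EFin \o (fun x => u x * v x)).
  by case/integrableP: (integrable_L2_mul u v).
transitivity (\int[mu]_x (a * (f x * h x) + g x * h x)).
  congr fine; apply: ae_eq_integral => //; first exact: mfg.
    apply/measurable_EFinP; apply: measurable_funD; last exact/measurable_EFinP/mfg.
    by apply: measurable_funM => //; exact/measurable_EFinP/mfg.
  apply: filterS (L2_funP a f g) => x /(_ I) -> _.
  by rewrite mulrDl mulrA.
rewrite RintegralD//.
- by rewrite RintegralZl//; exact: integrable_L2_mul.
- apply: eq_integrable (integrableZl measurableT a (integrable_L2_mul f h)) => //.
- exact: integrable_L2_mul.
Qed.

Lemma L2_dotBl f g h : L2_dot (f - g) h = L2_dot f h - L2_dot g h.
Proof. by rewrite addrC -scaleN1r L2_dotPl mulN1r addrC. Qed.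

Lemma L2_dotBr f g h : L2_dot h (f - g) = L2_dot h f - L2_dot h g.
Proof. by rewrite !(L2_dotC h) L2_dotBl. Qed.

Lemma L2_dot_eq0 f : L2_dot f f = 0 -> f = 0.
Proof.
move=> ff0; rewrite -(to_L2K f); apply/to_L2_ae0.
have /integrableP[mff _] := integrable_L2_mul f f.
have /(ae_eq_integral_abs _ measurableT mff) :
    (\int[mu]_x `|(f x * f x)%R%:E| = 0)%E.
  rewrite -[RHS]/(0%:E) -ff0 fineK; last first.
    exact: integrable_fin_num (integrable_L2_mul f f).
  by apply: eq_integral => x _; rewrite gee0_abs// lee_fin -expr2 sqr_ge0.
apply: filterS => x /(_ I) [] /eqP.
by rewrite mulf_eq0 orbb => /eqP.
Qed.

Lemma L2_cauchy_schwarz f g : `|L2_dot f g| <= `|f| * `|g|.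
Proof.
have ifg := integrable_L2_mul f g.
rewrite -lee_fin EFin_normr_Rintegral//.
case/integrableP: (ifg) => mfg _.
apply: (le_trans (le_abse_integral mu measurableT mfg)).
rewrite EFinM.
have nE (h : L2 mu) : `|h|%:E = ('N[mu]_2%:E[EFin \o h])%E.
  exact: finite_norm_fine.
rewrite !nE -Lnorm1.
by apply: hoelder => //; rewrite [RHS]splitr !div1r.
Qed.

(** The orthogonal complement of a vector is closed, because the inner product
is Lipschitz in its first argument. *)
Lemma closure_orthogonal (A : set (L2 mu)) g :
  (forall f, A f -> L2_dot f g = 0) -> forall f, closure A f -> L2_dot f g = 0.
Proof.
move=> Ag f clAf; apply/eqP; rewrite -normr_le0; apply/ler_addgt0Pl => e e0.
(* The added 1 keeps the radius [e / (`|g| + 1)] meaningful when [g = 0]. *)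
have g1 : 0 < `|g| + 1 by rewrite ltr_wpDl.
have [f' [Af' ff']] := clAf _ (nbhsx_ballx f (e / (`|g| + 1)) (divr_gt0 e0 g1)).
rewrite -ball_normE /= in ff'.
rewrite addr0 -[L2_dot f g]subr0 -(Ag _ Af') -L2_dotBl.
apply: (le_trans (L2_cauchy_schwarz _ _)).
rewrite -[leRHS](divfK (lt0r_neq0 g1)) ler_pM// ?ltW//.
by rewrite ltrDl.
Qed.

End L2_inner_product.

(** * Operators into a finite-dimensional space and their adjoints *)

(** Duality in finite dimension: the row space of [M] is the annihilator of the
column kernel of [M]. *)
Lemma submx_annihilator {F : fieldType} {m n p}
    (B : 'M[F]_(m, n)) (M : 'M[F]_(p, n)) :
  (forall c : 'cV[F]_n, M *m c = 0 -> B *m c = 0) -> (B <= M)%MS.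
Proof.
move=> MB; rewrite submxE; apply/eqP/trmx_inj/row_matrixP => j.
rewrite trmx0 row0 -tr_col colE -mulmxA MB ?trmx0//.
by rewrite mulmxA mulmx_coker mul0mx.
Qed.

(** For symmetric [G], the squared length of [G *m c] is [c^T *m (G *m (G *m c))]. *)
Lemma sym_sqr_mulmx_eq0 {R : realFieldType} {n} (G : 'M[R]_n) (c : 'cV[R]_n) :
  G^T = G -> G *m (G *m c) = 0 -> G *m c = 0.
Proof.
move=> Gsym GGc; set v := G *m c.
have : v^T *m v = 0 by rewrite trmx_mul Gsym -mulmxA GGc mulmx0.
move=> /matrixP/(_ ord0 ord0); rewrite !mxE => vv0.
apply/matrixP => i j; rewrite ord1 [RHS]mxE; apply/eqP; rewrite -sqrf_eq0.
have /psumr_eq0P vv : forall k, true -> 0 <= v^T ord0 k * v k ord0.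
  by move=> k _; rewrite mxE -expr2 sqr_ge0.
by have := vv vv0 i isT; rewrite mxE => /eqP; rewrite -expr2.
Qed.

Section finite_rank.
Context {d} {T : measurableType d} {R : realType}.
Context {mu : {measure set T -> \bar R}} {K : nat} {H : set (L2 mu)}.
Context {U : L2 mu -> 'I_K -> R} {Uadj : ('I_K -> R) -> L2 mu}.
Hypotheses (H_closed : closed_subspace H) (UadjP : is_adjoint H U Uadj).

Lemma subspaceB {f g} : H f -> H g -> H (f - g).
Proof.
by case: H_closed => _ Hlin _ Hf Hg; rewrite addrC -scaleN1r; exact: Hlin.
Qed.

Lemma subspaceD {f g} : H f -> H g -> H (f + g).
Proof. by case: H_closed => _ Hlin _ Hf Hg; rewrite -[f]scale1r; exact: Hlin. Qed.

Lemma adjoint_sum {h} q : H h ->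
  \sum_a U h a * q a = K%:R * L2_dot h (Uadj q).
Proof.
case: UadjP => _ adj Hh; rewrite -adj// /Q_dot.
have [K0|K0] := eqVneq (K%:R : R) 0; last by rewrite mulVKf.
rewrite K0 mul0r big1// => a _; move/eqP: K0; rewrite pnatr_eq0 => /eqP K0.
by have := ltn_ord a; rewrite [X in (_ < X)%N]K0.
Qed.

Let e (a : 'I_K) : 'I_K -> R := fun b => (b == a)%:R.

(** The vectors [K *: Uadj (e a)] are the Riesz representers of the coordinates
of [U]; in particular [U] is linear on [H], being the left half of an adjoint
pair. *)
Lemma adjoint_coord {h} a : H h -> U h a = K%:R * L2_dot h (Uadj (e a)).
Proof.
move=> Hh; rewrite -adjoint_sum// (bigD1 a)//= /e eqxx mulr1 big1 ?addr0//.
by move=> b /negPf ->; rewrite mulr0.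
Qed.

Lemma adjoint_opB {f g} : H f -> H g -> U (f - g) = U f \- U g.
Proof.
move=> Hf Hg; apply/funext => a /=.
by rewrite !adjoint_coord//; [rewrite L2_dotBl mulrBr|exact: subspaceB].
Qed.

(** [G] is the matrix of [U \o Uadj] acting on row vectors; by [adjoint_coord] it
is [K] times the Gram matrix of the vectors [Uadj (e a)], whence its symmetry. *)
Let G : 'M[R]_K := \matrix_(a, b) U (Uadj (e a)) b.

Let G_sym : G^T = G.
Proof.
case: UadjP => HU _; apply/matrixP => a b.
by rewrite !mxE !adjoint_coord// L2_dotC.
Qed.

Let UUadjE q : \row_a U (Uadj q) a = \row_a q a *m G.
Proof.
case: UadjP => HU _; apply/matrixP => i a.
rewrite mxE [RHS]mxE adjoint_coord// L2_dotC -adjoint_sum//.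
by apply: eq_bigr => b _; rewrite -[in RHS]G_sym !mxE mulrC.
Qed.

(** The kernel of [G *m G] is that of [G] by symmetry, and the latter consists
of the [q] with [Uadj q = 0], since [Uadj q] has squared norm a multiple of
q^T G q.  Such [q] annihilate the range of [U], so by duality every [U h] lies
in the row space of [G *m G]. *)
Lemma op_range_adjoint_sqr {h} : H h -> exists q, U h = U (Uadj (U (Uadj q))).
Proof.
case: (UadjP) => HU _ Hh.
have /submxP[D UhE] : (\row_a U h a <= G *m G)%MS.
  apply: submx_annihilator => c; rewrite -mulmxA.
  move=> /(sym_sqr_mulmx_eq0 _ _ G_sym) Gc.
  pose q a := c a 0.
  have Uq0 : \row_a U (Uadj q) a = 0.
    rewrite UUadjE -[RHS]trmx0 -Gc trmx_mul G_sym; congr (_ *m _).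
    by apply/matrixP => i j; rewrite !mxE !ord1.
  have adjq0 : Uadj q = 0.
    apply: L2_dot_eq0; case: (UadjP) => _ <- //.
    rewrite /Q_dot big1 ?mulr0// => a _.
    by move/matrixP/(_ 0 a): Uq0; rewrite !mxE => ->; rewrite mul0r.
  apply/matrixP => i j; rewrite !mxE !ord1.
  under eq_bigr do rewrite !mxE.
  by rewrite (adjoint_sum q)// adjq0 -(subrr 0) L2_dotBr subrr mulr0.
(* [D] is a matrix with one row; that row is the preimage. *)
exists (D 0); apply/funext => a.
have -> : U h a = (\row_a U h a) 0 a by rewrite mxE.
have -> : U (Uadj (U (Uadj (D 0)))) a = (\row_a U (Uadj (U (Uadj (D 0)))) a) 0 a.
  by rewrite mxE.
rewrite UhE !UUadjE mulmxA; congr ((_ *m _ *m _) _ _).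
by apply/matrixP => i j; rewrite !mxE ord1.
Qed.

(** If [q] satisfies [U f = U (Uadj (U (Uadj q)))], the difference between [f]
and [Uadj (U (Uadj q))] is both in the null space of [U] and orthogonal to it. *)
Lemma normal_range {f} : H f ->
  (forall n, H n -> U n = cst 0 -> L2_dot f n = 0) ->
  exists2 xi, H xi & Uadj (U xi) = f.
Proof.
case: (UadjP) => HU adj Hf fperp.
have [q Ufq] := op_range_adjoint_sqr Hf.
exists (Uadj q); first exact: HU.
set g := Uadj (U (Uadj q)); have Hg : H g by exact: HU.
have Hfg : H (f - g) by exact: subspaceB.
have Ufg : U (f - g) = cst 0.
  by rewrite adjoint_opB// Ufq; apply/funext => a /=; rewrite subrr.
apply/esym/eqP; rewrite -subr_eq0; apply/eqP/L2_dot_eq0.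
rewrite L2_dotBl fperp// L2_dotC -adj// Ufg /Q_dot big1 ?mulr0 ?subrr//.
by move=> a _; rewrite mul0r.
Qed.

Lemma adjoint_range_orthogonal q n : H n -> U n = cst 0 -> L2_dot (Uadj q) n = 0.
Proof.
case: UadjP => _ adj Hn Un; rewrite L2_dotC -adj// Un /Q_dot big1 ?mulr0//.
by move=> a _; rewrite mul0r.
Qed.

Lemma closure_adjoint_range : closure (range Uadj) `<=` (Uadj \o U) @` H.
Proof.
move=> f clf; case: (H_closed) => _ _ clH; case: (UadjP) => HU _.
have Hf : H f by apply/clH; apply: closureS clf => _ [q _ <-].
have [n Hn Un|xi Hxi xif] := normal_range Hf; last by exists xi.
apply: closure_orthogonal clf => _ [q _ <-].
exact: adjoint_range_orthogonal.
Qed.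

End finite_rank.

(** * Change of variables along a density *)

Section density.
Import HBNNSimple.
Local Open Scope ereal_scope.
Context {d} {T : measurableType d} {R : realType}.
Context {nu m : {measure set T -> \bar R}} {p : T -> R}.
Hypothesis pP : is_density nu m p.

Let mp : measurable_fun [set: T] (EFin \o p).
Proof. by case: pP => mp _ _; apply/measurable_EFinP. Qed.

Let p0 x : 0 <= (p x)%:E.
Proof. by case: pP => _ p0 _; rewrite lee_fin. Qed.

Lemma integral_density_nnsfun (h : {nnsfun T >-> R}) :
  \int[m]_x (h x)%:E = \int[nu]_x ((h x)%:E * (p x)%:E).
Proof.
case: pP => _ _ mE.
have mh r : measurable (h @^-1` [set r]) by exact: measurable_funPTI.
have mI r : measurable_fun [set: T] (fun x => (r * \1_(h @^-1` [set r]) x)%:E).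
  by apply/measurable_EFinP; exact: measurable_funM.
transitivity (\int[nu]_x (\sum_(r \in range h)
    ((r * \1_(h @^-1` [set r]) x)%:E * (p x)%:E))); last first.
  apply: eq_integral => x _; rewrite -ge0_mule_fsuml.
    by rewrite fsumEFin// -fimfunE.
  by move=> r; exact: nnfun_muleindic_ge0.
rewrite integralT_nnsfun sintegralE ge0_integral_fsum//; last 2 first.
- by move=> r; exact: emeasurable_funM.
- by move=> r x _; rewrite mule_ge0//; exact: nnfun_muleindic_ge0.
apply: eq_fsbigr => r /[!inE] -[x _ hxr].
have r0 : (0 <= r)%R by rewrite -hxr.
rewrite mE// integral_mkcond -ge0_integralZl//; last 2 first.
- by apply/(measurable_restrictT _ (mh r)); exact: measurable_funTS.
- by move=> y _; rewrite patchE; case: ifP.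
apply: eq_integral => y _; rewrite patchE indicE.
by case: ifP; rewrite ?mulr1 ?mulr0 ?mul0e ?mule0.
Qed.

Lemma ge0_integral_density (f : T -> \bar R) : measurable_fun [set: T] f ->
  (forall x, 0 <= f x) -> \int[m]_x f x = \int[nu]_x (f x * (p x)%:E).
Proof.
move=> mf f0; pose h := nnsfun_approx measurableT mf.
have hf x : (h n x)%:E @[n --> \oo] --> f x by exact: cvg_nnsfun_approx.
have ndh x : {homo (fun n => (h n x)%:E) : a b / (a <= b)%N >-> a <= b}.
  by move=> a b ab; rewrite lee_fin; exact/lefP/nd_nnsfun_approx.
have mh n : measurable_fun [set: T] (fun x => (h n x)%:E).
  exact/measurable_EFinP.
transitivity (limn (fun n => \int[m]_x (h n x)%:E)).
  rewrite -monotone_convergence//; last by move=> n x _; rewrite lee_fin.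
  by apply: eq_integral => x _; apply/esym/cvg_lim.
under eq_fun do rewrite integral_density_nnsfun.
rewrite -monotone_convergence//.
- apply: eq_integral => x _; apply/cvg_lim => //.
  by apply: cvgeZr => //; exact: hf.
- by move=> n; exact: emeasurable_funM.
- by move=> n x _; rewrite mule_ge0// lee_fin.
- by move=> x _ a b ab; rewrite lee_wpmul2r// ndh.
Qed.

(** Multiplication by [p >= 0] commutes with taking positive and negative
parts, so the formula holds for every measurable [f], even when both parts
have infinite integral. *)
Lemma integral_density (f : T -> \bar R) : measurable_fun [set: T] f ->
  \int[m]_x f x = \int[nu]_x (f x * (p x)%:E).
Proof.
move=> mf; rewrite integralE [RHS]integralE.
rewrite !ge0_integral_density//;
  [|exact: measurable_funeneg|exact: measurable_funepos].
congr (_ - _); apply: eq_integral => x _.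
- by rewrite !funeposE maxe_pMl// mul0e.
- by rewrite !funenegE maxe_pMl// mul0e mulNe.
Qed.

End density.

Section density_ratio.
Context {d} {T : measurableType d} {R : realType}.
Context {nu m m' : {measure set T -> \bar R}} {p p' : T -> R}.
Hypotheses (pP : is_density nu m p) (p'P : is_density nu m' p').
Hypothesis m'm : m' `<< m.

Lemma measurable_density_ratio : measurable_fun [set: T] (fun x => p' x / p x).
Proof.
case: (pP) => mp p0 _; case: (p'P) => mp' _ _.
apply: measurable_funM => //.
(* Measurability of the inverse is that of a real power, as [p >= 0]. *)
rewrite (_ : (fun x => (p x)^-1) = (fun x => p x `^ (-1))).
  exact: measurableT_comp (measurable_powR _) mp.
by apply/funext => x; rewrite powR_inv1.
Qed.

(** The quotient is meaningless where [p] vanishes, but that set is null for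
[m], hence for [m'] by absolute continuity, so [p'] vanishes there too, almost
everywhere for [nu]. *)
Lemma density_ratioK : p' = (fun x => p' x / p x * p x) %[ae nu].
Proof.
case: (pP) => mp _ mE; case: (p'P) => mp' p'0 m'E.
pose N := p @^-1` [set 0].
have mN : measurable N by rewrite -[N]setTI; exact: mp.
have mN0 : m N = 0%E.
  by rewrite mE// integral0_eq// => x ->.
have m'N0 : m' N = 0%E by apply: (null_content_dominatesP _ _).1 mN0.
have mp'N : measurable_fun N (EFin \o p').
  by apply/measurable_EFinP; exact: measurable_funTS.
have /(ae_eq_integral_abs _ mN mp'N) : (\int[nu]_(x in N) `|(EFin \o p') x| = 0)%E.
  rewrite -m'N0 m'E//; apply: eq_integral => x _.
  by rewrite gee0_abs// lee_fin.
apply: filterS => x /= p'x _; have [px0|px0] := eqVneq (p x) 0.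
  by have [->] := p'x px0; rewrite !mul0r.
by rewrite divfK.
Qed.

Lemma integral_density_ratio (f : T -> R) : measurable_fun [set: T] f ->
  (\int[m']_x (f x)%:E = \int[m]_x (f x * (p' x / p x))%:E)%E.
Proof.
case: (pP) => mp _ _; case: (p'P) => mp' _ _ mf.
have mr : measurable_fun [set: T] (fun x => f x * (p' x / p x)).
  by apply: measurable_funM => //; exact: measurable_density_ratio.
rewrite (integral_density p'P); last exact/measurable_EFinP.
rewrite (integral_density pP); last exact/measurable_EFinP.
apply: ae_eq_integral => //.
- by apply/measurable_EFinP; exact: measurable_funM.
- by apply/measurable_EFinP; exact: measurable_funM.
apply: filterS density_ratioK => x /(_ I) /= p'x _.
by rewrite -!EFinM -mulrA -p'x.
Qed.

End density_ratio.

(** The positive and negative parts are transported separately, which makes the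
formula valid whether or not the expectation is finite. *)
Lemma expectation_distribution {d d'} {T : measurableType d} {T' : measurableType d'}
    {R : realType} (P : probability T R) (X : {RV P >-> T'}) (f : T' -> R) :
  measurable_fun [set: T'] f ->
  ('E_P[f \o X] = \int[distribution P X]_y (f y)%:E)%E.
Proof.
move=> mf; have mEf : measurable_fun [set: T'] (EFin \o f).
  exact/measurable_EFinP.
rewrite unlock integralE [RHS]integralE; congr (_ - _)%E.
- rewrite ge0_integral_distribution//; last exact: measurable_funepos.
  by apply: eq_integral => x _; rewrite /= !funeposE.
- rewrite ge0_integral_distribution//; last exact: measurable_funeneg.
  by apply: eq_integral => x _; rewrite /= !funenegE.
Qed.

(** * The target functional as an inner product with the density ratio *)

Section target.
Context {d} {Omega : measurableType d} {R : realType} {P : probability Omega R}.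
Context {d'} {T : measurableType d'} {S : {RV P >-> T}}.
Context {d''} {Omega' : measurableType d''} {P' : probability Omega' R}.
Context {Snew : {RV P' >-> T}}.
Context {nu : {measure set T -> \bar R}} {p_S p_Snew : T -> R}.
Context {rho : L2 (distribution P S)}.
Hypotheses (p_SP : is_density nu (distribution P S) p_S)
  (p_SnewP : is_density nu (distribution P' Snew) p_Snew)
  (dom : distribution P' Snew `<< distribution P S)
  (rhoE : \forall x \ae distribution P S, rho x = p_Snew x / p_S x).

Lemma thetaE h : theta Snew h = L2_dot rho h.
Proof.
have mh := measurable_L2_fun h.
rewrite /theta expectation_distribution// (integral_density_ratio p_SP p_SnewP)//.
congr fine; apply: ae_eq_integral => //.
- apply/measurable_EFinP; apply: measurable_funM => //.
  exact: measurable_density_ratio p_SP p_SnewP.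
- by apply/measurable_EFinP; exact: measurable_funM.
- by apply: filterS rhoE => x -> _; rewrite mulrC.
Qed.

End target.

(** * Identification and strong identification *)

Theorem theorem4 (R : realType) (K : nat)
    (d : measure_display) (Omega : measurableType d) (P : probability Omega R)
    (A : Omega -> 'I_K) (A_uniform : uniform_treatment P A)
    (d' : measure_display) (T : measurableType d') (S : {RV P >-> T})
    (H : set (L2 (distribution P S))) (H_closed : closed_subspace H)
    (TKadj : ('I_K -> R) -> L2 (distribution P S))
    (TKadjP : is_adjoint H (cond_op P A S) TKadj) :
  [/\ closure (range TKadj) = range TKadj,
      range TKadj = (TKadj \o cond_op P A S) @` H &
      forall (Y : {RV P >-> R}) (hstar : L2 (distribution P S))
        (d'' : measure_display) (Omega' : measurableType d'')
        (P' : probability Omega' R) (Snew : {RV P' >-> T})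
        (nu : {measure set T -> \bar R}) (p_S p_Snew : T -> R)
        (rho alpha : L2 (distribution P S)),
        P.-integrable setT (EFin \o Y) ->
        H hstar -> (forall a, cond_op P A S hstar a = cond_mean P A Y a) ->
        is_density nu (distribution P S) p_S ->
        is_density nu (distribution P' Snew) p_Snew ->
        distribution P' Snew `<< distribution P S ->
        (\forall x \ae distribution P S, rho x = p_Snew x / p_S x) ->
        is_projection H rho alpha ->
        identified P A S Snew Y H hstar <->
        strongly_identified H (cond_op P A S) TKadj alpha].
Proof.
have normal_sub : (TKadj \o cond_op P A S) @` H `<=` range TKadj.
  by move=> _ [xi _ <-]; exists (cond_op P A S xi).
have cl_sub := closure_adjoint_range H_closed TKadjP.
split.
- apply/seteqP; split; last exact: subset_closure.
  exact: subset_trans cl_sub normal_sub.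
- apply/seteqP; split => //.
  exact: subset_trans (@subset_closure _ _) cl_sub.
move=> Y hstar d'' Omega' P' Snew nu p_S p_Snew rho alpha _ Hstar YE.
move=> p_SP p_SnewP dom rhoE [Halpha alphaE].
have theta_diff g h : H g -> H h ->
    theta Snew g - theta Snew h = L2_dot alpha (g - h).
  move=> Hg Hh; rewrite !(thetaE p_SP p_SnewP dom rhoE) -L2_dotBr.
  by apply/eqP; rewrite -subr_eq0 -L2_dotBl alphaE//; exact: subspaceB.
split=> [ident|[xi Hxi xiE] h Hh hE].
(* Perturb [hstar] by a null vector [n] of the operator. *)
- apply: (normal_range H_closed TKadjP) => // n Hn Un.
  have Hsn := subspaceD H_closed Hstar Hn.
  have E : hstar + n - hstar = n by rewrite addrC addKr.
  rewrite -E -theta_diff//; apply/eqP; rewrite subr_eq0; apply/eqP.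
  apply: ident => // a; rewrite -YE; apply/eqP; rewrite -subr_eq0.
  have := congr1 (@^~ a) (adjoint_opB H_closed TKadjP Hsn Hstar).
  by rewrite E Un /= => <-.
- apply/eqP; rewrite -subr_eq0 theta_diff// -xiE; apply/eqP.
  apply: (adjoint_range_orthogonal TKadjP); first exact: subspaceB.
  rewrite (adjoint_opB H_closed TKadjP)//; apply/funext => a /=.
  by rewrite hE YE subrr.
Qed.
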